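(* Let $Y\in\Omega_n^r$ be a random simplicial complex with respect to $\mathbb{P}_{r,\mathfrak p}$, where $\mathfrak p=(p_0,p_1,\dots,p_r)$, $p_i=n^{-\alpha_i}$, and $\alpha=\alpha(n)=(\alpha_0,\dots,\alpha_r)\in\mathbb{R}_+^{r+1}$ is a sequence of vectors converging to a vector $\alpha_\ast\in\mathfrak{D}_k$, where $1\le k\le r$. Then $b_0(Y)=1$, i.e. $Y$ is connected, a.a.s.
   Context: Model. Fix an integer $r$. Let $\Delta_n$ be the simplex with vertex set $\{1,\dots,n\}$, viewed as an abstract simplicial complex. For a subcomplex $Y\subset\Delta_n$, $f_i(Y)$ is the number of $i$-dimensional simplexes of $Y$, and $e_i(Y)$ is the number of $i$-dimensional external faces of $Y$, i.e. $i$-simplexes $\sigma\subset\Delta_n$ with $\sigma\not\subset Y$ but $\partial\sigma\subset Y$ (for $i=0$: vertices not in $Y$). $\Omega_n^r$ is the set of all subcomplexes $Y\subset\Delta_n$ with $\dim Y\le r$ (including the empty one). For $\mathfrak p=(p_0,\dots,p_r)$ with $0\le p_i\le 1$ the probability measure on $\Omega_n^r$ is $$\mathbb{P}_{r,\mathfrak p}(Y)=\prod_{i=0}^r p_i^{f_i(Y)}\cdot\prod_{i=0}^r(1-p_i)^{e_i(Y)},\qquad 0^0=1.$$ Notation. $\mathbb{R}_+=[0,\infty)$. For $\alpha=(\alpha_0,\dots,\alpha_r)$ and $k=0,\dots,r$ put $\psi_k(\alpha)=\sum_{i=0}^r\binom{k}{i}\alpha_i$, with $\binom{k}{i}=0$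 for $i>k$ and $\binom00=1$. Domains: $\mathfrak{D}_k=\{\alpha\in\mathbb{R}^{r+1}_+:\psi_k(\alpha)<1<\psi_{k+1}(\alpha)\}$ for $0\le k\le r-1$, and $\mathfrak{D}_r=\{\alpha\in\mathbb{R}^{r+1}_+:\psi_r(\alpha)<1\}$. $b_0(Y)$ is the zeroth Betti number of $Y$ (number of connected components). ''A.a.s.'' means with probability tending to $1$ as $n\to\infty$. *)

(* Defs.v *)
From HB Require Import structures.
From mathcomp Require Import all_boot all_order all_algebra.
From mathcomp Require Import all_classical all_reals all_analysis.

Set Implicit Arguments.
Unset Strict Implicit.
Unset Printing Implicit Defensive.

Import Order.TTheory GRing.Theory Num.Theory.
Import numFieldNormedType.Exports.

Local Open Scope classical_set_scope.
Local Open Scope ring_scope.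

(* The vertex set {1, ..., n} is 'I_n. A simplex of Delta_n is a nonempty     *)
(* s : {set 'I_n}, of dimension #|s| - 1. A subcomplex is the set of its      *)
(* (nonempty) simplexes, so that set0 : {set {set 'I_n}} is the empty complex *)
(* and set0 : {set 'I_n} is never a simplex.                                  *)

Definition is_subcomplex (n : nat) (Y : {set {set 'I_n}}) : bool :=
  (finset.set0 \notin Y) &&
  [forall s : {set 'I_n}, forall t : {set 'I_n},
     [&& s \in Y, t != finset.set0 & t \subset s] ==> (t \in Y)].

Definition Omega (n r : nat) : {set {set {set 'I_n}}} :=
  [set Y : {set {set 'I_n}} |
     is_subcomplex Y && [forall s in Y, #|s| <= r.+1]%N]%SET.

Definition num_faces (n : nat) (Y : {set {set 'I_n}}) (i : nat) : nat :=
  #|[set s in Y | #|s| == i.+1]%SET|.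

Definition boundary_in (n : nat) (s : {set 'I_n}) (Y : {set {set 'I_n}}) :
    bool :=
  [forall t : {set 'I_n}, (t != finset.set0) && (t \proper s) ==> (t \in Y)].

(* For i = 0 the boundary condition is vacuous: these are the vertices of     *)
(* Delta_n that are not in Y.                                                 *)
Definition num_ext_faces (n : nat) (Y : {set {set 'I_n}}) (i : nat) : nat :=
  #|[set s : {set 'I_n} |
       [&& #|s| == i.+1, s \notin Y & boundary_in s Y]]%SET|.

Definition weight (R : realType) (n r : nat) (p : 'I_r.+1 -> R)
    (Y : {set {set 'I_n}}) : R :=
  (\prod_(i < r.+1) p i ^+ num_faces Y i) *
  (\prod_(i < r.+1) (1 - p i) ^+ num_ext_faces Y i).

Definition Pr (R : realType) (n r : nat) (p : 'I_r.+1 -> R)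
    (A : pred {set {set 'I_n}}) : R :=
  \sum_(Y in Omega n r | A Y) weight p Y.

Definition vertices (n : nat) (Y : {set {set 'I_n}}) : {set 'I_n} :=
  [set v : 'I_n | [set v]%SET \in Y]%SET.

(* Reflexive on the vertices of Y, since [set v; v] = [set v].                *)
Definition adj (n : nat) (Y : {set {set 'I_n}}) : rel 'I_n :=
  fun u v => [set u; v]%SET \in Y.

(* The connected components of Y are those of its 1-skeleton. The empty       *)
(* complex has b0 = 0.                                                        *)
Definition b0 (n : nat) (Y : {set {set 'I_n}}) : nat :=
  n_comp (adj Y) (vertices Y).

Definition psi (R : realType) (r k : nat) (a : 'rV[R]_r.+1) : R :=
  \sum_(i < r.+1) 'C(k, i)%:R * a ord0 i.

Definition nonneg_vec (R : realType) (r : nat) : set 'rV[R]_r.+1 :=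
  [set a | forall i, 0 <= a ord0 i].

(* Meaningful for k <= r only.                                                *)
Definition Dom (R : realType) (r k : nat) : set 'rV[R]_r.+1 :=
  [set a | nonneg_vec a /\
     if (k < r)%N then psi k a < 1 < psi k.+1 a else psi k a < 1].

Definition prob_vec (R : realType) (r n : nat) (a : 'rV[R]_r.+1) :
    'I_r.+1 -> R :=
  fun i => n%:R `^ (- a ord0 i).

(* Main.v *)
Require Import Defs.
From HB Require Import structures.
From mathcomp Require Import all_boot all_order all_algebra.

Set Implicit Arguments.
Unset Strict Implicit.
Unset Printing Implicit Defensive.

Import Order.TTheory GRing.Theory Num.Theory.

Local Open Scope ring_scope.

(** Connectedness only concerns the 1-skeleton, and the measure can be
    generated one dimension at a time: once the faces of dimension less than
    j are known, each j-simplex whose boundary is present is added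
    independently with probability p_j ([sum_complexesS]). The layers of
    dimension at least 2 therefore integrate to 1
    ([sum_complexes_skeleton]), and what remains is a binomial random graph on
    a binomial random vertex set: a vertex is kept with probability p_0, an
    edge between kept vertices with probability p_1.

    If this graph on N > 0 vertices is disconnected, some vertex set S, neither
    empty nor everything, has none of the #|S| (N - #|S|) edges to its
    complement ([disconnected_cut]). Given the vertices this has probability
    (1 - p_1)^(#|S| (N - #|S|)). When N >= m it is at most
    y^#|S| + y^(N - #|S|) with y = exp (- p_1 m / 2), and summing over S with
    the binomial theorem gives at most 2 ((1 + y)^N - 1)
    ([disconnected_given_vertices_le]). The event N < m, with m = n p_0 / 4, is
    handled by the exponential Markov inequality ([Pr_disconnected_le]).

    On the domain with k >= 1 the limit vector satisfies
    alpha_0 + alpha_1 <= psi_k < 1 ([psi_ge_vertex_edge]), so that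
    n p_0 p_1 >= n^d eventually for some d > 0. Every error term is then
    controlled by t = n exp (- n^d / 8), which tends to 0
    ([cvg_nat_mul_expR_powR]). *)

(** * Binomial random subsets *)

Section RandomSubset.
Variables (R : comNzRingType) (I : finType).
Implicit Types (E F C : {set I}) (p x y : R).

(** The binomial theorem, with one term for each subset. *)
Lemma sum_powerset_expr x y E :
  \sum_(F in powerset E) x ^+ #|F| * y ^+ #|E :\: F| = (x + y) ^+ #|E|.
Proof.
rewrite -prodr_const [RHS]big_mkcond /=.
transitivity (\prod_i ((if i \in E then x else 0) + (if i \in E then y else 1))).
  rewrite bigA_distr [LHS]big_mkcond; apply: eq_bigr => F _ /=.
  rewrite powersetE; case: ifP => [sFE|/negbT/subsetPn[i iF iE]]; last first.
    by rewrite (bigD1 i) //= iF (negbTE iE) mul0r.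
  rewrite (bigID (mem F)) /= -!prodr_const; congr (_ * _).
    by apply: eq_bigr => i iF; rewrite iF (subsetP sFE).
  rewrite big_mkcond [RHS]big_mkcond; apply: eq_bigr => i _ /=.
  by rewrite inE; case: (i \in F).
by apply: eq_bigr => i _; case: ifP; rewrite ?add0r.
Qed.

(** The law of the random subset of E that keeps each element independently
    with probability p. *)
Definition subset_weight p E F := p ^+ #|F| * (1 - p) ^+ #|E :\: F|.

Lemma sum_subset_weight p E : \sum_(F in powerset E) subset_weight p E F = 1.
Proof. by rewrite sum_powerset_expr addrC subrK expr1n. Qed.

(** The elements of C are discarded independently of the choices made in
    E :\: C, which sum to 1. *)
Lemma sum_subset_weight_disjoint p E C : C \subset E ->
  \sum_(F in powerset E | [disjoint F & C]) subset_weight p E F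
    = (1 - p) ^+ #|C|.
Proof.
move=> sCE; have := sum_subset_weight p (E :\: C).
move/(congr1 ( *%R ((1 - p) ^+ #|C|))); rewrite mulr1 => <-; rewrite mulr_sumr.
have subE F : (F \in powerset E) && [disjoint F & C] = (F \in powerset (E :\: C)).
  by rewrite !powersetE subsetD.
rewrite (eq_bigl _ _ subE); apply: eq_bigr => F; rewrite powersetE subsetD.
case/andP=> sFE dFC; rewrite /subset_weight [RHS]mulrCA -exprD; congr (_ * _ ^+ _).
rewrite -(cardsID C (E :\: F)); congr (_ + _)%N; apply: eq_card => i.
  rewrite !inE; case: (boolP (i \in C)) => iC; last by rewrite andbF.
  by rewrite (subsetP sCE) // (disjointFl dFC iC).
by rewrite !inE andbCA.
Qed.

End RandomSubset.

(** * Generating the complex one dimension at a time *)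

Section Skeleta.
Variable n : nat.
Implicit Types (Y Z F : {set {set 'I_n}}) (s t : {set 'I_n}) (S : {set 'I_n}).

(** Indexing by the largest number of vertices of a face, rather than by the
    dimension, makes the empty complex the base case j = 0 of the induction on
    layers. *)
Definition complexes (j : nat) : {set {set {set 'I_n}}} :=
  [set Y : {set {set 'I_n}} |
     is_subcomplex Y && [forall s in Y, #|s| <= j]%N].

Lemma OmegaE r : Omega n r = complexes r.+1. Proof. by []. Qed.

Definition skeleton (j : nat) Y : {set {set 'I_n}} :=
  [set s in Y | #|s| <= j]%N.

(** The simplexes of dimension j that may be added to a complex of dimension
    less than j. *)
Definition addable (j : nat) Z : {set {set 'I_n}} :=
  [set s : {set 'I_n} | (#|s| == j.+1) && boundary_in s Z].

Lemma complexesP j Y :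
  reflect [/\ set0 \notin Y,
              forall s t, s \in Y -> t != set0 -> t \subset s -> t \in Y
            & forall s, s \in Y -> (#|s| <= j)%N]
          (Y \in complexes j).
Proof.
rewrite inE; apply: (iffP andP) => [[/andP[Y0 /forallP Yd] /forallP Yj]|].
  split=> // [s t sY t0 ts|s]; last by move/(implyP (Yj s)).
  by have /forallP/(_ t)/implyP := Yd s; apply; rewrite sY t0.
case=> Y0 Yd Yj; split; last by apply/forallP=> s; apply/implyP/Yj.
rewrite /is_subcomplex Y0; apply/forallP=> s; apply/forallP=> t.
by apply/implyP=> /and3P[*]; apply: (Yd s).
Qed.

Lemma boundary_inP s Y :
  reflect (forall t, t != set0 -> t \proper s -> t \in Y) (boundary_in s Y).
Proof.
apply: (iffP forallP) => [H t t0 ts|H t]; first by apply: (implyP (H t)); rewrite t0.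
by apply/implyP=> /andP[]; apply: H.
Qed.

Lemma complexes0 : complexes 0 = [set set0].
Proof.
apply/setP=> Y; rewrite [RHS]inE; apply/complexesP/eqP => [[Y0 _ Yj]|->].
  apply/setP=> s; rewrite inE; apply/negP=> sY.
  have := Yj _ sY; rewrite leqn0 cards_eq0 => /eqP s0.
  by rewrite s0 (negbTE Y0) in sY.
by split=> [|s t|s]; rewrite inE.
Qed.

Lemma skeleton_complexes j j' Y : Y \in complexes j' -> skeleton j Y \in complexes j.
Proof.
case/complexesP=> Y0 Yd Yj; apply/complexesP; split=> [|s t|s].
- by rewrite inE (negbTE Y0).
- rewrite !inE => /andP[sY sj] t0 ts; rewrite (Yd s) //=.
  exact: leq_trans (subset_leq_card ts) sj.
- by rewrite inE => /andP[].
Qed.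

(** Adding simplexes of dimension j changes neither the faces nor the external
    faces of lower dimension, and among the addable simplexes those left out
    become exactly the external faces of dimension j. *)
Section AddLayer.
Variables (j : nat) (Z F : {set {set 'I_n}}).
Hypotheses (Zj : Z \in complexes j) (FE : F \subset addable j Z).

Let cardF s : s \in F -> #|s| = j.+1.
Proof. by move/(subsetP FE); rewrite inE => /andP[/eqP]. Qed.

Let mem_small s : (#|s| <= j)%N -> (s \in Z :|: F) = (s \in Z).
Proof.
move=> sj; rewrite inE orbC; case: (boolP (s \in F)) => // /cardF sF.
by rewrite sF ltnn in sj.
Qed.

Let notZ s : #|s| = j.+1 -> (s \in Z) = false.
Proof.
move=> sj; apply/negP; case/complexesP: Zj => _ _ H /H.
by rewrite sj ltnn.
Qed.

Let boundary_small s :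
  (#|s| <= j.+1)%N -> boundary_in s (Z :|: F) = boundary_in s Z.
Proof.
move=> sj; apply/boundary_inP/boundary_inP => H t t0 ts.
  rewrite -mem_small ?H //; have := proper_card ts.
  by move/leq_trans/(_ sj).
by rewrite inE H.
Qed.

Lemma add_layer_complexes : Z :|: F \in complexes j.+1.
Proof.
case/complexesP: (Zj) => Z0 Zd Zs; apply/complexesP; split=> [|s t|s].
- by rewrite mem_small ?cards0.
- rewrite inE => /orP[sZ t0 ts|sF t0 ts]; first by rewrite inE (Zd s).
  have [->|nts] := eqVneq t s; first by rewrite inE sF orbT.
  have := subsetP FE s sF; rewrite inE => /andP[_ /boundary_inP H].
  by rewrite inE H // properEneq nts.
- by rewrite inE => /orP[/Zs/leqW|/cardF->].
Qed.

Lemma skeleton_add_layer i : (i <= j)%N -> skeleton i (Z :|: F) = skeleton i Z.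
Proof.
move=> ij; apply/setP=> s; rewrite inE [RHS]inE.
case: (leqP #|s| i) => si; last by rewrite !andbF.
by rewrite mem_small // (leq_trans si).
Qed.

Lemma setD_add_layer : (Z :|: F) :\: Z = F.
Proof.
apply/setP=> s; rewrite !inE; case: (boolP (s \in F)) => [/cardF/notZ->//|_].
by rewrite orbF andNb.
Qed.

Lemma num_faces_add_layer i : (i < j)%N -> num_faces (Z :|: F) i = num_faces Z i.
Proof.
move=> ij; apply: eq_card => s; rewrite inE [RHS]inE.
by case: eqP => [si|]; rewrite ?andbF // mem_small // si.
Qed.

Lemma num_ext_faces_add_layer i :
  (i < j)%N -> num_ext_faces (Z :|: F) i = num_ext_faces Z i.
Proof.
move=> ij; apply: eq_card => s; rewrite inE [RHS]inE.
case: eqP => [si|] //; rewrite mem_small ?si // boundary_small // si.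
exact: leqW.
Qed.

Lemma num_faces_add_layer_top : num_faces (Z :|: F) j = #|F|.
Proof.
apply: eq_card => s; rewrite !inE; case: eqP => [/notZ->|sj]; first by rewrite andbT.
by rewrite andbF; apply/esym/negP=> /cardF.
Qed.

Lemma num_ext_faces_add_layer_top : num_ext_faces (Z :|: F) j = #|addable j Z :\: F|.
Proof.
apply: eq_card => s; rewrite !inE; case: eqP => [sj|]; rewrite ?andbF //=.
by rewrite notZ //= boundary_small ?sj.
Qed.

End AddLayer.

Section Weight.
Variables (R : comNzRingType) (p : nat -> R).

(** The sequence p is indexed by [nat] so that the induction may shorten the
    product without changing the type of p. *)
Definition layer_weight (j : nat) Y : R :=
  \prod_(i < j) (p i ^+ num_faces Y i * (1 - p i) ^+ num_ext_faces Y i).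

Lemma layer_weight_add j Z F : Z \in complexes j -> F \subset addable j Z ->
  layer_weight j.+1 (Z :|: F)
    = layer_weight j Z * subset_weight (p j) (addable j Z) F.
Proof.
move=> Zj FE; rewrite /layer_weight big_ord_recr /= num_faces_add_layer_top //.
rewrite num_ext_faces_add_layer_top //; congr (_ * _); apply: eq_bigr => i _.
by rewrite (num_faces_add_layer FE) // (num_ext_faces_add_layer FE).
Qed.

(** A complex of dimension j is, uniquely, its skeleton of dimension j - 1
    together with a set of addable j-simplexes, and the weight factors
    accordingly. *)
Lemma sum_complexesS j (G : {set {set 'I_n}} -> R) :
  \sum_(Y in complexes j.+1) layer_weight j.+1 Y * G Y =
  \sum_(Z in complexes j) layer_weight j Z *
     \sum_(F in powerset (addable j Z))
        subset_weight (p j) (addable j Z) F * G (Z :|: F).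
Proof.
rewrite (partition_big (skeleton j) (mem (complexes j))) /=; last first.
  by move=> Y; apply: skeleton_complexes.
apply: eq_bigr => Z Zj.
have splitE Y : (Y \in complexes j.+1) && (skeleton j Y == Z) ->
    Z :|: (Y :\: Z) = Y.
  case/andP=> _ /eqP <-; apply/setP=> s; rewrite !inE.
  by case: (s \in Y); rewrite ?andbF //= andbT orbN.
rewrite (reindex_onto _ _ splitE) mulr_sumr.
have condE F : ((Z :|: F \in complexes j.+1) && (skeleton j (Z :|: F) == Z))
    && ((Z :|: F) :\: Z == F) = (F \in powerset (addable j Z)).
  rewrite powersetE; apply/idP/idP; last first.
    move=> FE; rewrite add_layer_complexes // (skeleton_add_layer FE) //.
    rewrite (setD_add_layer Zj FE) eqxx andbT; apply/eqP/setP=> s; rewrite inE.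
    by case: (boolP (s \in Z)) => //=; case/complexesP: Zj => _ _; apply.
  case/andP=> /andP[/complexesP[Y0 Yd Ys] /eqP skY] /eqP FD.
  apply/subsetP=> s sF; move: (sF); rewrite -FD !inE sF orbT andbT => sZ.
  have sY : s \in Z :|: F by rewrite inE sF orbT.
  have sj : #|s| = j.+1.
    apply/eqP; rewrite eqn_leq Ys //= ltnNge; apply: contra sZ => sj.
    by rewrite -skY inE sY.
  rewrite sj eqxx; apply/boundary_inP=> t t0 ts.
  rewrite -skY inE (Yd s) // ?proper_sub //=.
  by have := proper_card ts; rewrite sj.
rewrite (eq_bigl _ _ condE); apply: eq_bigr => F; rewrite powersetE => FE.
by rewrite layer_weight_add // mulrA.
Qed.

(** The layers above the i-th have total mass 1 given the lower ones, so a
    quantity that only depends on the skeleton does not see them. *)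
Lemma sum_complexes_skeleton i j (G : {set {set 'I_n}} -> R) : (i <= j)%N ->
  \sum_(Y in complexes j) layer_weight j Y * G (skeleton i Y) =
  \sum_(Y in complexes i) layer_weight i Y * G Y.
Proof.
move=> /subnK <-; elim: (j - i)%N => [|m IHm].
  rewrite add0n; apply: eq_bigr => Y /complexesP[_ _ Ys]; congr (_ * G _).
  by apply/setP=> s; rewrite inE; case: (boolP (s \in Y)) => //= /Ys.
rewrite addSn (sum_complexesS _ (fun Y => G (skeleton i Y))) -IHm.
apply: eq_bigr => Z Zj; congr (_ * _).
rewrite -[RHS]mul1r -(sum_subset_weight (p (m + i)%N) (addable (m + i) Z)).
rewrite mulr_suml; apply: eq_bigr => F; rewrite powersetE => FE.
by rewrite (skeleton_add_layer FE) // leq_addl.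
Qed.

Lemma sum_layer_weight j : \sum_(Y in complexes j) layer_weight j Y = 1.
Proof.
have := sum_complexes_skeleton (fun=> 1) (leq0n j).
under eq_bigr do rewrite mulr1.
by move=> ->; rewrite complexes0 big_set1 mulr1 /layer_weight big_ord0.
Qed.

End Weight.

(** Over the empty complex the addable simplexes are the n vertices. *)
Lemma addable0_card : #|addable 0 (set0 : {set {set 'I_n}})| = n.
Proof.
rewrite -[RHS]card_ord -[RHS]bin1 -card_draws; apply: eq_card => s.
rewrite !inE andb_idr // => /eqP s1; apply/boundary_inP=> t t0 /proper_card.
by rewrite s1 ltnS leqn0 cards_eq0 (negbTE t0).
Qed.

(** * Cuts of the 1-skeleton *)

Section Cuts.
Variable (Z : {set {set 'I_n}}).
Hypothesis Z1 : Z \in complexes 1.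

Lemma card_vertices : #|vertices Z| = #|Z|.
Proof.
rewrite -(card_imset _ set1_inj); apply: eq_card => s.
apply/imsetP/idP => [[v vZ ->]|sZ]; first by rewrite inE in vZ.
case/complexesP: Z1 => Z0 _ /(_ s sZ) s1.
have /cards1P[v sE] : #|s| == 1%N.
  rewrite eqn_leq s1 card_gt0; apply: contraNneq Z0 => <- //.
by exists v => //; rewrite inE -sE.
Qed.

Definition cut_edges S : {set {set 'I_n}} :=
  [set [set uv.1; uv.2] | uv in setX S (vertices Z :\: S)].

Lemma cut_edges_addable S : S \subset vertices Z -> cut_edges S \subset addable 1 Z.
Proof.
move=> sS; apply/subsetP=> _ /imsetP[[u v] /setXP[/= uS /setDP[vV vS]] ->].
have nuv : u != v by apply: contraNneq vS => <-.
rewrite inE cards2 nuv; apply/boundary_inP=> t t0 tp.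
have : #|t| == 1%N.
  rewrite eqn_leq card_gt0 t0 andbT.
  by have := proper_card tp; rewrite cards2 nuv.
case/cards1P=> w tE; move: (proper_sub tp); rewrite tE sub1set.
have uV := subsetP sS u uS; rewrite !inE in uV vV.
by case/set2P=> ->.
Qed.

Lemma card_cut_edges S : S \subset vertices Z ->
  #|cut_edges S| = (#|S| * (#|Z| - #|S|))%N.
Proof.
move=> sS; rewrite card_in_imset; last first.
  move=> [u v] [u' v'] /setXP[/= uS /setDP[vV vS]] /setXP[/= uS' /setDP[_ vS']].
  move/setP=> E; have := E u; rewrite !inE eqxx /=.
  have := E v; rewrite !inE eqxx orbT /=.
  have [E1 _|_] := eqVneq v u'; first by rewrite E1 uS' in vS.
  move=> /esym/eqP ->; have [->//|_] := eqVneq u u'.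
  by move=> /esym/eqP E2; rewrite -E2 uS in vS'.
by rewrite cardsX cardsD (setIidPr sS) card_vertices.
Qed.

End Cuts.

Lemma connect_adj_sym Y : connect_sym (adj Y).
Proof. by apply: sym_connect_sym => u v; rewrite /adj setUC. Qed.

(** Take for S the connected component of some vertex. *)
Lemma disconnected_cut Z F : Z \in complexes 1 -> F \subset addable 1 Z ->
  (0 < #|Z|)%N -> b0 (Z :|: F) != 1%N ->
  exists2 S : {set 'I_n}, [&& S \subset vertices Z, S != set0 & S != vertices Z]
    & [disjoint F & cut_edges Z S].
Proof.
move=> Z1 FE; rewrite -card_vertices // => /card_gt0P[v vV] b0Y.
set Y := Z :|: F in b0Y *; have Y2 : Y \in complexes 2 by apply: add_layer_complexes.
have VE : vertices Y = vertices Z.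
  apply/setP=> w; rewrite !inE; case: (boolP ([set w] \in F)); rewrite ?orbF //.
  by move/(subsetP FE); rewrite inE cards1.
have adjV u w : adj Y u w -> w \in vertices Y.
  case/complexesP: Y2 => _ Yd _ uw; rewrite inE; apply: (Yd _ _ uw).
    by rewrite -card_gt0 cards1.
  by rewrite sub1set !inE eqxx orbT.
have clV w : connect (adj Y) v w -> w \in vertices Y.
  case/connectP=> q qp ->; elim/last_ind: q qp => [|q x _]; first by rewrite VE.
  by rewrite rcons_path last_rcons => /andP[_]; apply: adjV.
exists [set w | connect (adj Y) v w].
  apply/and3P; split; first by apply/subsetP=> w; rewrite inE -VE; apply: clV.
    by apply/set0Pn; exists v; rewrite inE connect0.
  apply: contra b0Y => /eqP SE; rewrite /b0.
  rewrite -(n_comp_connect (connect_adj_sym Y) v); apply/eqP/eq_n_comp_r => w.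
  by rewrite VE -SE inE.
apply/pred0P=> s /=; apply/negP=> /andP[sF /imsetP[[u w]]].
rewrite !inE /= => /andP[vu /andP[/negP nvw _]] sE; apply: nvw.
apply: connect_trans vu (connect1 _); rewrite /adj -sE.
by rewrite inE sF orbT.
Qed.

Lemma b0_skeleton j Y : (2 <= j)%N -> b0 (skeleton j Y) = b0 Y.
Proof.
move=> j2; have VE : vertices (skeleton j Y) = vertices Y.
  by apply/setP=> v; rewrite !inE cards1 (ltnW j2) andbT.
have adjE : adj (skeleton j Y) =2 adj Y.
  move=> u v; rewrite /adj inE cards2 andb_idr // => _.
  by apply: leq_trans j2; case: (_ == _).
by rewrite /b0 VE; apply: eq_n_comp => u v; apply: eq_connect.
Qed.

End Skeleta.

From mathcomp Require Import all_classical all_reals all_analysis.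
From mathcomp Require Import lra.

Import numFieldNormedType.Exports.
Local Open Scope classical_set_scope.

(** * Probability of being disconnected *)

Section FailureBound.
Variable R : realType.

Lemma subset_weight_ge0 (I : finType) (q : R) (E F : {set I}) :
  0 <= q <= 1 -> 0 <= subset_weight q E F.
Proof.
by case/andP=> q0 q1; rewrite mulr_ge0 // exprn_ge0 // subr_ge0.
Qed.

Lemma weightE n r (p : 'I_r.+1 -> R) (Y : {set {set 'I_n}}) :
  weight p Y = layer_weight (fun i => p (inord i)) r.+1 Y.
Proof.
rewrite /weight /layer_weight big_split /=; congr (_ * _);
by apply: eq_bigr => i _; rewrite inord_val.
Qed.

Lemma PrC n r (p : 'I_r.+1 -> R) (A : pred {set {set 'I_n}}) :
  Pr p A = 1 - Pr p (fun Y => ~~ A Y).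
Proof.
rewrite -(sum_layer_weight n (fun i => p (inord i)) r.+1) -OmegaE.
rewrite (bigID A) /= /Pr.
under [in X in _ - X]eq_bigr do rewrite weightE.
by rewrite addrK; apply: eq_bigr => Y _; rewrite weightE.
Qed.

Lemma Pr_ge0 n r (p : 'I_r.+1 -> R) (A : pred {set {set 'I_n}}) :
  (forall i, 0 <= p i <= 1) -> 0 <= Pr p A.
Proof.
move=> p01; apply: sumr_ge0 => Y _; apply: mulr_ge0; apply: prodr_ge0 => i _;
by case/andP: (p01 i) => p0 p1; rewrite exprn_ge0 // subr_ge0.
Qed.

(** Only the edge layer, over a set Z of vertices, is left. *)
Lemma Pr_disconnectedE n r (p : 'I_r.+1 -> R) : (1 <= r)%N ->
  Pr p (fun Y : {set {set 'I_n}} => b0 Y != 1%N) =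
  \sum_(Z in complexes n 1) layer_weight (fun i => p (inord i)) 1 Z *
     \sum_(F in powerset (addable 1 Z))
        subset_weight (p (inord 1)) (addable 1 Z) F * (b0 (Z :|: F)%SET != 1%N)%:R.
Proof.
move=> r1; rewrite -(sum_complexesS (fun i => p (inord i)) 1
  (fun Y => (b0 Y != 1%N)%:R)).
rewrite -(sum_complexes_skeleton _ _ (r1 : 2 <= r.+1)%N) /Pr OmegaE big_mkcondr.
apply: eq_bigr => Y _; rewrite b0_skeleton // weightE.
by case: ifP; rewrite ?mulr1 ?mulr0.
Qed.

(** Union bound over the cuts. Each of the two terms in the hypothesis on y
    contributes at most (1 + y)^N - 1: in the binomial expansion over all S,
    the excluded set S = set0 has y^#|S| = 1, and the excluded set S = V has
    y^(N - #|S|) = 1. *)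
Lemma disconnected_given_vertices_le n (q y : R) (Z : {set {set 'I_n}}) :
  Z \in complexes n 1 -> (0 < #|Z|)%N -> 0 <= q <= 1 -> 0 <= y ->
  (forall s, (0 < s < #|Z|)%N ->
     (1 - q) ^+ (s * (#|Z| - s)) <= y ^+ s + y ^+ (#|Z| - s)) ->
  \sum_(F in powerset (addable 1 Z))
     subset_weight q (addable 1 Z) F * (b0 (Z :|: F)%SET != 1%N)%:R
  <= 2 * ((1 + y) ^+ #|Z| - 1).
Proof.
move=> Z1 Z0 q01 y0 qy; set V := vertices Z; set E := addable 1 Z.
have cV : #|V| = #|Z| by apply: card_vertices.
pose proper_part (S : {set 'I_n}) := (S != finset.set0) && (S != V).
apply: (@le_trans _ _ (\sum_(S in powerset V | proper_part S)
          \sum_(F in powerset E | [disjoint F & cut_edges Z S]) subset_weight q E F : R)).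
  rewrite [leRHS](exchange_big_dep (mem (powerset E))) /=; last by move=> ? ? _ /andP[].
  apply: ler_sum => F FE.
  have w0 := subset_weight_ge0 E F q01.
  case: (boolP (_ == _)) => b1; first by rewrite mulr0 sumr_ge0.
  rewrite mulr1; move: FE; rewrite powersetE => FE.
  have [S /and3P[SV S0 SnV] dS] := disconnected_cut Z1 FE Z0 b1.
  rewrite (bigD1 S) /=; first by rewrite lerDl sumr_ge0.
  by rewrite !powersetE SV FE dS /proper_part S0 SnV.
have card_part S : (S \in powerset V) && proper_part S -> (0 < #|S| < #|Z|)%N.
  rewrite powersetE => /and3P[SV S0 SnV]; rewrite card_gt0 S0 -cV.
  by apply: proper_card; rewrite finset.properEneq SnV.
apply: (@le_trans _ _ (\sum_(S in powerset V | proper_part S)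
                         (y ^+ #|S| + y ^+ #|V :\: S|%SET))).
  apply: ler_sum => S SP; case/andP: (SP); rewrite powersetE => SV _.
  rewrite sum_subset_weight_disjoint ?cut_edges_addable // card_cut_edges //.
  by rewrite cardsDS // cV; apply: qy; apply: card_part.
rewrite big_split mulr_natl mulr2n; apply: lerD.
  have := sum_powerset_expr y 1 V; rewrite cV addrC => <-.
  rewrite [in leRHS](bigD1 finset.set0) ?powersetE ?finset.sub0set //= finset.cards0 expr0 expr1n mulr1.
  rewrite addrC addrK [leLHS]big_mkcond [leRHS]big_mkcond ler_sum // => S _.
  rewrite expr1n mulr1 /proper_part; case: (S \in _) => //=.
  by case: (S != _) => //=; case: (S != _) => //=; rewrite exprn_ge0.
have := sum_powerset_expr 1 y V; rewrite cV => <-.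
rewrite [in leRHS](bigD1 V) ?powersetE //= finset.setDv finset.cards0 expr0 expr1n mulr1.
rewrite addrC addrK [leLHS]big_mkcond [leRHS]big_mkcond ler_sum // => S _.
rewrite expr1n mul1r /proper_part; case: (S \in _) => //=.
by case: (S != V); case: (S != _) => //=; rewrite exprn_ge0.
Qed.

(** The larger side of the cut has at least N / 2 >= m / 2 vertices, so the
    number of crossing edges is at least m / 2 times the size of the smaller
    side, whichever of the two it is. *)
Lemma cut_probability_le (q m : R) (N s : nat) :
  0 <= q <= 1 -> m <= N%:R -> (0 < s < N)%N ->
  let y := expR (- (q * m / 2)) in
  (1 - q) ^+ (s * (N - s)) <= y ^+ s + y ^+ (N - s).
Proof.
move=> /andP[q0 q1] mN /andP[s0 sN] /=.
have y0 := expR_ge0 (- (q * m / 2)).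
have qe : 1 - q <= expR (- q) by apply: expR_ge1Dx.
have q1' : 0 <= 1 - q by rewrite subr_ge0.
(* t is the size of the smaller side, u that of the larger one *)
have key t u : (t + u = N)%N -> (t <= u)%N ->
    (1 - q) ^+ (t * u) <= expR (- (q * m / 2)) ^+ t.
  move=> tu le_tu; apply: (le_trans (lerXn2r _ _ _ qe)).
  - by rewrite nnegrE.
  - by rewrite nnegrE expR_ge0.
  rewrite -!expRM_natl ler_expR natrM -mulrA ler_wpM2l //.
  have tuR : t%:R <= u%:R :> R by rewrite ler_nat.
  have : N%:R <= 2 * u%:R :> R by rewrite -tu natrD; lra.
  by nra.
have [le_s|lt_s] := leqP s (N - s).
  by rewrite (le_trans (key _ _ _ le_s)) ?lerDl ?exprn_ge0 ?subnKC 1?ltnW.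
rewrite mulnC (le_trans (key (N - s)%N s _ _)) ?lerDr ?exprn_ge0 ?subnK //; exact: ltnW.
Qed.

Lemma expr1D_le_expR (y : R) (n : nat) : 0 <= y -> (1 + y) ^+ n <= expR (n%:R * y).
Proof.
move=> y0; rewrite expRM_natl lerXn2r // ?expR_ge1Dx // nnegrE ?expR_ge0 //.
by rewrite addr_ge0.
Qed.

(** The number N of vertices is binomial and the indicator of N < m is at most
    exp (m - N), whose mean is exp m (1 - p_0 (1 - 1/e))^n; the first term
    uses 1 - 1/e >= 1/2. For N >= m the second term bounds the probability of
    a cut without edges, with N replaced by n. *)
Lemma Pr_disconnected_le n r (p : 'I_r.+1 -> R) (m : R) :
  (1 <= r)%N -> (forall i, 0 <= p i <= 1) -> 0 < m ->
  Pr p (fun Y : {set {set 'I_n}} => b0 Y != 1%N)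
  <= expR (m - n%:R * p (inord 0) / 2)
     + 2 * (expR (n%:R * expR (- (p (inord 1) * m / 2))) - 1).
Proof.
move=> r1 p01 m0; rewrite Pr_disconnectedE //.
set y := expR (- _); set c := 2 * (_ - 1).
have y0 : 0 <= y by apply: expR_ge0.
have c0 : 0 <= c.
  by rewrite mulr_ge0 // subr_ge0 -expR0 ler_expR mulr_ge0.
apply: (@le_trans _ _ (\sum_(Z in complexes n 1)
   layer_weight (fun i => p (inord i)) 1 Z * (expR (m - #|Z|%:R) + c))).
  apply: ler_sum => Z Z1; apply: ler_wpM2l.
    rewrite /layer_weight big_ord1 mulr_ge0 // exprn_ge0 //.
      by case/andP: (p01 (inord 0)).
    by rewrite subr_ge0; case/andP: (p01 (inord 0)).
  (* with few vertices, bound the conditional probability by 1 *)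
  have [Nm|mN] := ltP #|Z|%:R m.
    apply: (@le_trans _ _ (\sum_(F in powerset (addable 1 Z))
               subset_weight (p (inord 1)) (addable 1 Z) F : R)).
      apply: ler_sum => F _; rewrite ler_piMr ?subset_weight_ge0 //.
      by case: (_ != _).
    rewrite sum_subset_weight -[leLHS]addr0 lerD // -[leLHS]expR0 ler_expR.
    by rewrite subr_ge0 ltW.
  apply: (@le_trans _ _ (2 * ((1 + y) ^+ #|Z| - 1))).
    apply: disconnected_given_vertices_le => //.
      by rewrite -(ltr_nat R) (lt_le_trans m0).
    by move=> s sN; apply: cut_probability_le.
  rewrite -[leLHS]add0r lerD ?expR_ge0 // ler_wpM2l // lerB //.
  apply: le_trans (expr1D_le_expR _ y0) _; rewrite ler_expR ler_wpM2r // ler_nat.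
  by rewrite -(card_vertices Z1) -[leqRHS]card_ord max_card.
rewrite (sum_complexesS _ 0 (fun Z => expR (m - #|Z|%:R) + c)) complexes0 big_set1.
rewrite {1}/layer_weight big_ord0 mul1r; set E := addable 0 _; set q := p _.
under eq_bigr do rewrite finset.set0U mulrDr.
rewrite big_split /= -mulr_suml sum_subset_weight mul1r lerD2r.
have -> : \sum_(F in powerset E) subset_weight q E F * expR (m - #|F|%:R) =
   expR m * (q * expR (-1) + (1 - q)) ^+ n.
  rewrite -[in RHS](addable0_card n) -sum_powerset_expr mulr_sumr.
  apply: eq_bigr => F _; rewrite expRD -mulrN1 expRM_natl exprMn /subset_weight.
  by rewrite [LHS]mulrCA; congr (_ * _); exact: mulrAC.
rewrite expRD ler_wpM2l ?expR_ge0 // -mulrA -mulrN expRM_natl.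
have q01 : 0 <= q <= 1 by apply: p01.
have e2 : expR (-1) <= 2^-1 :> R.
  by rewrite expRN lef_pV2 ?posrE ?expR_gt0 //; have := expR_ge1Dx (1 : R); lra.
have e0 := expR_ge0 (-1 : R).
apply: lerXn2r; rewrite ?nnegrE ?expR_ge0 //; first by nra.
by apply: le_trans (expR_ge1Dx _); nra.
Qed.

End FailureBound.

(** * Asymptotics *)

Section Asymptotics.
Variable R : realType.

(** The exponential beats every power: with d K >= 2, the inequality
    exp x >= (x / K)^K at x = n^d / 8 yields exp (n^d / 8) >= n^2 / (8 K)^K,
    so that the product is at most (8 K)^K / n. *)
Lemma cvg_nat_mul_expR_powR (d : R) : 0 < d ->
  (fun n : nat => n%:R * expR (- (n%:R `^ d / 8))) @ \oo --> (0 : R).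
Proof.
move=> d0; pose K := (Num.Def.archi_bound (2 / d)).
have dK : 2 <= d * K%:R.
  have /archi_boundP/ltW : 0 <= 2 / d by rewrite divr_ge0 // ltW.
  by rewrite -/K ler_pdivrMr // mulrC.
have K0 : 0 < K%:R :> R by move: dK; rewrite -(pmulr_rgt0 K%:R d0); lra.
(* the factor 2 absorbs the shift in the harmonic sequence: 1 / n <= 2 / (n + 1) *)
pose C : R := 2 * (8 * K%:R) ^+ K.
apply: (@squeeze_cvgr nat \oo _ R (fun=> 0) (fun n => C * harmonic n)).
- exists 1%N => // n /= n1; have n0 : 0 < n%:R :> R by rewrite ltr0n.
  rewrite mulr_ge0 ?expR_ge0 //= expRN.
  have ed : (n%:R `^ d / 8 / K%:R) ^+ K <= expR (n%:R `^ d / 8).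
    have {2}-> : n%:R `^ d / 8 = K%:R * (n%:R `^ d / 8 / K%:R).
      by rewrite [RHS]mulrC divfK ?gt_eqF.
    rewrite expRM_natl lerXn2r ?nnegrE ?expR_ge0 //.
    by apply: le_trans (expR_ge1Dx _); rewrite lerDr.
  have nn : n%:R ^+ 2 <= (n%:R `^ d) ^+ K :> R.
    rewrite -!powR_mulrn ?powR_ge0 // -powRrM ler_powR // ler1n //.
  have nd : n%:R ^+ 2 <= (8 * K%:R) ^+ K * expR (n%:R `^ d / 8).
    apply: le_trans nn _; rewrite mulrC -ler_pdivrMr ?exprn_gt0 ?mulr_gt0 //.
    by rewrite -expr_div_n invfM mulrA.
  rewrite ler_pdivrMr ?expR_gt0 // /C /harmonic /= mulrAC ler_pdivlMr ?ltr0n //.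
  rewrite -mulrA; apply: le_trans (_ : 2 * n%:R ^+ 2 <= _).
    have : 1 <= n%:R :> R by rewrite ler1n.
    by rewrite -[n.+1]addn1 natrD; set x := n%:R; nra.
  by rewrite ler_wpM2l.
- exact: cvg_cst.
- rewrite -[X in _ --> X](mulr0 C); apply: cvgM; [exact: cvg_cst|exact: cvg_harmonic].
Qed.

(** The terms i = 0 and i = 1 of psi_k have coefficients 1 and k. *)
Lemma psi_ge_vertex_edge r k (a : 'rV[R]_r.+1) : (1 <= k <= r)%N -> nonneg_vec a ->
  a ord0 (inord 0) + a ord0 (inord 1) <= psi k a.
Proof.
case/andP=> k1 kr a0; have r1 := leq_trans k1 kr.
rewrite /psi (bigD1 (inord 0)) // inordK //= bin0 mul1r lerD2l.
rewrite (bigD1 (inord 1)) /=; last by rewrite -val_eqE /= !inordK.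
rewrite inordK // bin1 -[leLHS]addr0 lerD ?sumr_ge0 //.
  by rewrite -[leLHS]mul1r ler_wpM2r ?ler1n.
by move=> i _; rewrite mulr_ge0.
Qed.

Lemma prob_vec_itv r n (a : 'rV[R]_r.+1) i : (0 < n)%N -> nonneg_vec a ->
  0 <= prob_vec n a i <= 1.
Proof.
move=> n0 a0; rewrite powR_ge0 /= -(powRr0 n%:R) ler_powR ?ler1n //.
by rewrite oppr_le0.
Qed.

(** The choice m = n p_0 / 4 makes the exponents - n p_0 / 4 and
    - n p_0 p_1 / 8; both are at most - n^d / 8, because
    n p_0 >= n p_0 p_1 >= n^d. *)
Lemma Pr_disconnected_prob_vec_le r n (a : 'rV[R]_r.+1) (d : R) :
  (0 < n)%N -> (1 <= r)%N -> nonneg_vec a ->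
  a ord0 (inord 0) + a ord0 (inord 1) <= 1 - d ->
  Pr (prob_vec n a) (fun Y : {set {set 'I_n}} => b0 Y != 1%N)
  <= n%:R * expR (- (n%:R `^ d / 8))
     + 2 * (expR (n%:R * expR (- (n%:R `^ d / 8))) - 1).
Proof.
move=> n0 r1 a0 ad; have p01 := fun i => prob_vec_itv i n0 a0.
set p0 := prob_vec n a (inord 0); set p1 := prob_vec n a (inord 1).
have n1 : 1 <= n%:R :> R by rewrite ler1n.
have nd : n%:R `^ d <= n%:R * p0 * p1.
  rewrite -[X in X * p0](@powRr1 _ n%:R) // /p0 /p1 /prob_vec -!powRD ?lt0r_neq0 ?ltr0n ?implybT //.
  by rewrite ler_powR //; lra.
have /andP[p0_ge0 p0_le1] : 0 <= p0 <= 1 by apply: p01.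
have /andP[p1_ge0 p1_le1] : 0 <= p1 <= 1 by apply: p01.
have np0 : n%:R `^ d <= n%:R * p0.
  by apply: le_trans nd _; rewrite ler_piMr // mulr_ge0.
have m0 : 0 < n%:R * p0 / 4.
  by rewrite divr_gt0 // (lt_le_trans _ np0) // powR_gt0 // ltr0n.
apply: le_trans (Pr_disconnected_le n r1 p01 m0) _; rewrite -/p0 -/p1.
have nd0 := powR_ge0 n%:R d.
apply: lerD.
  apply: (@le_trans _ _ (expR (- (n%:R `^ d / 8)))); first by rewrite ler_expR; lra.
  by rewrite ler_peMl // expR_ge0.
rewrite ler_wpM2l // lerB // ler_expR ler_wpM2l // ler_expR.
by lra.
Qed.

End Asymptotics.

Theorem theorem16 (R : realType) (r k : nat) (hk : (1 <= k <= r)%N)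
  (alpha : nat -> 'rV[R]_r.+1) (alpha_star : 'rV[R]_r.+1)
  (halpha : forall n, nonneg_vec (alpha n))
  (hcvg : alpha @ \oo --> alpha_star)
  (hstar : Dom k alpha_star) :
  (fun n : nat => Pr (prob_vec n (alpha n))
     (fun Y : {set {set 'I_n}} => b0 Y == 1%N)) @ \oo --> (1 : R).
Proof.
case: hstar => star0 psi1; have /andP[k1 kr] := hk; have r1 := leq_trans k1 kr.
have {}psi1 : psi k alpha_star < 1 by case: ifP psi1 => // _ /andP[].
set s := alpha_star ord0 (inord 0) + alpha_star ord0 (inord 1).
have s1 : s < 1 by apply: le_lt_trans (psi_ge_vertex_edge hk star0) psi1.
pose d := (1 - s) / 2; have d0 : 0 < d by rewrite divr_gt0 // subr_gt0.
have coord i : (fun n => alpha n ord0 i) @ \oo --> alpha_star ord0 i.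
  exact: (cvg_comp _ _ hcvg (@coord_continuous _ _ _ ord0 i alpha_star)).
have near_d : \forall n \near \oo,
    alpha n ord0 (inord 0) + alpha n ord0 (inord 1) <= 1 - d.
  apply: (cvgr_le s); first exact: cvgD (coord _) (coord _).
  by rewrite /d; lra.
pose t (n : nat) : R := n%:R * expR (- (n%:R `^ d / 8)).
have t0 : t @ \oo --> (0 : R) by apply: cvg_nat_mul_expR_powR.
apply: (@squeeze_cvgr nat \oo _ R (fun n => 1 - (t n + 2 * (expR (t n) - 1)))
  (fun=> 1)).
- near=> n.
  have n0 : (0 < n)%N by near: n; exists 1%N.
  have nd : alpha n ord0 (inord 0) + alpha n ord0 (inord 1) <= 1 - d by near: n.
  rewrite PrC lerD2l lerN2 Pr_disconnected_prob_vec_le //= gerBl Pr_ge0 // => i.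
  exact: prob_vec_itv.
- rewrite -[X in _ --> X](_ : 1 - (0 + 2 * (expR 0 - 1)) = 1 :> R); last first.
    by rewrite expR0; lra.
  apply: cvgB; first exact: cvg_cst.
  apply: cvgD => //; apply: cvgM; first exact: cvg_cst.
  apply: cvgB; last exact: cvg_cst.
  exact: (cvg_comp _ _ t0 (@continuous_expR R 0)).
- exact: cvg_cst.
Unshelve. all: by end_near. Qed.
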